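(* Let $n\ge 2$, let $\boldsymbol{\omega}=(\omega_1,\dots,\omega_n)$ be a Chebyshev system on an interval $I\subset\mathbb{R}$ such that $(\omega_1,\dots,\omega_{n-1})$ is also a Chebyshev system on $I$, and let $f:I\to\mathbb{R}$. Then $$[x_2,\dots,x_{n+1};f]_{\boldsymbol{\omega}}-[x_1,\dots,x_n;f]_{\boldsymbol{\omega}}=\frac{D_n(x_1,\dots,x_{n+1};f)\,V_{n-1}(x_2,\dots,x_n)}{V_n(x_2,\dots,x_{n+1})\,V_n(x_1,\dots,x_n)}$$ for any $n+1$ distinct points $x_1,\dots,x_{n+1}\in I$ (in any order).
   Context: Let $I\subset\mathbb{R}$ be an interval and $\omega_1,\dots,\omega_n:I\to\mathbb{R}$ continuous functions. For $m\in\{n-1,n\}$ and $m$ distinct points $y_1,\dots,y_m\in I$ put $V_m(y_1,\dots,y_m)=\det\bigl(\omega_i(y_j)\bigr)_{i,j=1}^m$ (row $i$ corresponds to the function $\omega_i$, column $j$ to the point $y_j$). For $f:I\to\mathbb{R}$ and $m+1$ distinct points $y_1,\dots,y_{m+1}\in I$ let $D_m(y_1,\dots,y_{m+1};f)$ be the determinant of the $(m+1)\times(m+1)$ matrix whose $i$-th row, for $i=1,\dots,m$, is $(\omega_i(y_1),\dots,\omega_i(y_{m+1}))$ and whose last row is $(f(y_1),\dots,f(y_{m+1}))$. A system $(\omega_1,\dots,\omega_m)$ of continuous functions is a Chebyshev system on $I$ if $V_m(y_1,\dots,y_m)\neq 0$ for all $y_1<\dots<y_m$ in $I$. If $(\omega_1,\dots,\omega_n)$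 and $(\omega_1,\dots,\omega_{n-1})$ are Chebyshev systems on $I$, the generalized divided difference at $n$ distinct points $y_1,\dots,y_n\in I$ is $$[y_1,\dots,y_n;f]_{\boldsymbol{\omega}}=\frac{D_{n-1}(y_1,\dots,y_n;f)}{V_n(y_1,\dots,y_n)}.$$ *)

(* Defs.v *)
From HB Require Import structures.
From mathcomp Require Import all_boot all_order all_algebra.
From mathcomp Require Import all_classical all_reals all_analysis.
Set Implicit Arguments.
Unset Strict Implicit.
Unset Printing Implicit Defensive.
Import Order.TTheory GRing.Theory Num.Theory.
Import numFieldNormedType.Exports.
Local Open Scope classical_set_scope.
Local Open Scope ring_scope.

(* A real function on I is represented by a total function
   R -> R; only its values on I matter, and continuity on I is continuity for
   the subspace topology of I. *)

Definition ord_init {T : Type} {n : nat} (u : 'I_n -> T) : 'I_n.-1 -> T :=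
  fun i => u (widen_ord (leq_pred n) i).

Definition ord_tail {T : Type} {n : nat} (u : 'I_n.+1 -> T) : 'I_n -> T :=
  fun i => u (lift ord0 i).

Definition V {R : realType} {m : nat} (w : 'I_m -> R -> R) (y : 'I_m -> R) : R :=
  \det (\matrix_(i < m, j < m) w i (y j)).

(* The size m of the matrix is the number of points, so there are m - 1
   functions w; insub i is None exactly when i is the last row. *)
Definition D {R : realType} {m : nat}
    (w : 'I_m.-1 -> R -> R) (y : 'I_m -> R) (f : R -> R) : R :=
  \det (\matrix_(i < m, j < m)
    if insub (i : nat) is Some k then w k (y j) else f (y j)).

Definition chebyshev_system {R : realType} {m : nat}
    (I : set R) (w : 'I_m -> R -> R) : Prop :=
  (forall i, {within I, continuous (w i)}) /\
  (forall y : 'I_m -> R, (forall j, I (y j)) ->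
     (forall j k : 'I_m, (j < k)%N -> y j < y k) -> V w y != 0).

Definition divided_difference {R : realType} {n : nat}
    (w : 'I_n -> R -> R) (y : 'I_n -> R) (f : R -> R) : R :=
  D (ord_init w) y f / V w y.

(* Main.v *)
Require Import Defs.
From HB Require Import structures.
From mathcomp Require Import all_boot all_order all_algebra.
From mathcomp Require Import perm.
From mathcomp Require Import all_classical all_reals all_analysis.
From mathcomp Require Import ring.
Import Order.TTheory GRing.Theory Num.Theory.
Import numFieldNormedType.Exports.
Local Open Scope classical_set_scope.
Local Open Scope ring_scope.

(** Clearing denominators, and writing [n = k + 1], the identity says that
      [D_k(tail x; f) V_n(init x) - D_k(init x; f) V_n(tail x)
         = D_n(x; f) V_k(z)],
    where [z] is the list of the interior points, those common to [init x] and
    [tail x].  This is an instance of the Desnanot-Jacobi identity, but the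
    Chebyshev hypothesis on the first [k] functions gives a shorter way to it.

    Since [V_k(z) != 0], some combination of [omega_1, ..., omega_k]
    interpolates [f] at [z] ([V_interpolation]).  Subtracting it from [f] leaves
    the three determinants [D] unchanged ([D_sub_comb]), because each has
    [omega_1, ..., omega_k] among its rows.  So [f] may be supposed to vanish at
    all the interior points.  Expanding along the last row ([D_expand]) then
    leaves only the terms of the two extreme points,
      [D_k(tail x; f) = f(x_(n+1)) V_k(z)],
      [D_k(init x; f) = (-1)^k f(x_1) V_k(z)],
      [D_n(x; f) = (-1)^n f(x_1) V_n(tail x) + f(x_(n+1)) V_n(init x)],
    and the identity follows because [(-1)^n = - (-1)^k].

    The denominators are nonzero although the points need not be increasing:
    sorting the points changes [V] only by a sign ([V_neq0_distinct]). *)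

(** * Distinct points in any order *)

Lemma V_perm {R : realType} {m : nat} (w : 'I_m -> R -> R) (y : 'I_m -> R)
    (s : 'S_m) :
  V w (y \o s) = V w y * (-1) ^+ s.
Proof.
rewrite /V -odd_permV -det_perm -det_mulmx -col_permE.
by congr (\det _); apply/matrixP => i j; rewrite !mxE.
Qed.

Lemma sorting_perm {R : realType} {m : nat} (y : 'I_m -> R) : injective y ->
  exists s : 'S_m, forall j k : 'I_m, (j < k)%N -> y (s j) < y (s k).
Proof.
move=> y_inj; pose t := [tuple y i | i < m].
have /tuple_permP[s st] : perm_eq (sort <=%R t) t by rewrite perm_sort.
exists s => j k jk.
have t_lt : sorted <%R (sort <=%R t).
  by rewrite sort_lt_sorted map_inj_uniq ?enum_uniq.
have tE (i : 'I_m) : nth 0 (sort <=%R t) i = y (s i).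
  by rewrite st -tnth_nth !tnth_mktuple.
have sz : size (sort <=%R t) = m by rewrite size_sort size_tuple.
by rewrite -!tE lt_sorted_ltn_nth ?inE ?sz.
Qed.

Lemma V_neq0_distinct {R : realType} {m : nat} (I : set R)
    (w : 'I_m -> R -> R) (y : 'I_m -> R) :
  chebyshev_system I w -> (forall j, I (y j)) -> injective y -> V w y != 0.
Proof.
move=> [_ chebw] yI /sorting_perm[s s_incr].
have := chebw (y \o s) (fun j => yI (s j)) s_incr.
by rewrite V_perm mulf_eq0 signr_eq0 orbF.
Qed.

(** * The determinant D as a functional of its last row *)

(** All that is used of [D] follows from this formula: it shows at once that
    [D] is linear in [f] and depends only on the values of [f] at the points. *)
Lemma D_expand {R : realType} {k : nat} (w : 'I_k -> R -> R)
    (y : 'I_k.+1 -> R) (f : R -> R) :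
  D (m := k.+1) w y f =
  \sum_j f (y j) * ((-1) ^+ (k + j) * V w (fun i => y (lift j i))).
Proof.
rewrite /D (expand_det_row _ ord_max); apply: eq_bigr => j _.
rewrite mxE insubN ?ltnn//; congr (_ * (_ * \det _)).
by apply/matrixP => i l; rewrite !mxE lift_max valK.
Qed.

(** The determinant has two equal rows. *)
Lemma D_row {R : realType} {k : nat} (w : 'I_k -> R -> R)
    (y : 'I_k.+1 -> R) (i : 'I_k) :
  D (m := k.+1) w y (w i) = 0.
Proof.
apply: (@determinant_alternate _ _ _ (lift ord_max i) ord_max).
  by rewrite eq_sym neq_lift.
by move=> j; rewrite !mxE lift_max valK insubN ?ltnn.
Qed.

Lemma D_sub_comb {R : realType} {k : nat} (w : 'I_k -> R -> R)
    (y : 'I_k.+1 -> R) (f : R -> R) (c : 'I_k -> R) :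
  D (m := k.+1) w y (fun t => f t - \sum_i c i * w i t) = D (m := k.+1) w y f.
Proof.
rewrite !D_expand; under eq_bigr do rewrite mulrBl mulr_suml.
rewrite sumrB exchange_big/= [X in _ - X]big1 ?subr0// => i _.
under eq_bigr do rewrite -mulrA.
by rewrite -mulr_sumr -D_expand D_row mulr0.
Qed.

(** This is Cramer's rule: the coefficients solve a linear system whose
    determinant is [V w z]. *)
Lemma V_interpolation {R : realType} {k : nat} (w : 'I_k -> R -> R)
    (z : 'I_k -> R) (f : R -> R) : V w z != 0 ->
  exists c : 'I_k -> R, forall j, f (z j) = \sum_i c i * w i (z j).
Proof.
rewrite /V; set M := \matrix_(i, j) _ => M_neq0.
pose F : 'rV[R]_k := \row_j f (z j).
exists (fun i => (F *m invmx M) 0 i) => j.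
have /rowP/(_ j) : F *m invmx M *m M = F.
  by rewrite mulmxKV// unitmxE unitfE.
rewrite !mxE => <-; apply: eq_bigr => i _.
by rewrite [M i j]mxE.
Qed.

(** * The identity for a function vanishing at the interior points *)

Section Endpoints.
Context {R : realType} {k : nat}.
Implicit Types (f : R -> R).

Lemma ord_tail_init (x : 'I_k.+2 -> R) :
  ord_tail (ord_init x) = ord_init (ord_tail x) :> ('I_k -> R).
Proof.
by apply/funext => i; congr (x _); apply: val_inj; rewrite /= /bump.
Qed.

Lemma ord_initE {T : Type} {m : nat} (u : 'I_m.+1 -> T) i :
  ord_init u i = u (lift ord_max i).
Proof.
by congr (u _); apply: val_inj; rewrite /= /bump leqNgt ltn_ord.
Qed.

Lemma comp_lift_max {T : Type} {m : nat} (u : 'I_m.+1 -> T) :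
  (fun i => u (lift ord_max i)) = ord_init u.
Proof. by apply/funext => i; rewrite ord_initE. Qed.

Lemma D_vanishing_init (w : 'I_k -> R -> R) (y : 'I_k.+1 -> R) f :
  (forall i, f (ord_init y i) = 0) ->
  D (m := k.+1) w y f = f (y ord_max) * V w (ord_init y).
Proof.
move=> f0; rewrite D_expand big_ord_recr/= big1 => [|i _]; last first.
  have -> : y (widen_ord (leqnSn k) i) = ord_init y i.
    by congr (y _); apply: val_inj.
  by rewrite f0 mul0r.
by rewrite add0r addnn -signr_odd odd_double mul1r comp_lift_max.
Qed.

Lemma D_vanishing_tail (w : 'I_k -> R -> R) (y : 'I_k.+1 -> R) f :
  (forall i, f (ord_tail y i) = 0) ->
  D (m := k.+1) w y f = (-1) ^+ k * f (y ord0) * V w (ord_tail y).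
Proof.
move=> f0; rewrite D_expand big_ord_recl/= big1 => [|i _]; last first.
  by rewrite -/(ord_tail y i) f0 mul0r.
by rewrite addr0 addn0 mulrCA mulrA.
Qed.

Lemma D_vanishing_interior (w : 'I_k.+1 -> R -> R) (x : 'I_k.+2 -> R) f :
  (forall i, f (ord_init (ord_tail x) i) = 0) ->
  D (m := k.+2) w x f = (-1) ^+ k.+1 * f (x ord0) * V w (ord_tail x)
    + f (x ord_max) * V w (ord_init x).
Proof.
move=> f0; rewrite D_expand big_ord_recl big_ord_recr/= big1 => [|i _].
  rewrite add0r addn0 mulrCA mulrA; congr (_ + _).
  have -> : lift ord0 ord_max = ord_max :> 'I_k.+2 by apply: val_inj.
  by rewrite /bump add1n addnn -signr_odd odd_double mul1r comp_lift_max.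
have -> : x (lift ord0 (widen_ord (leqnSn k) i)) = ord_init (ord_tail x) i.
  by congr (x _); apply: val_inj.
by rewrite f0 mul0r.
Qed.

End Endpoints.

(** The case of the Desnanot-Jacobi identity in which the central minor
    [V (ord_init w) (ord_init (ord_tail x))] is nonzero. *)
Lemma D_three_term {R : realType} {k : nat} (w : 'I_k.+1 -> R -> R)
    (x : 'I_k.+2 -> R) (f : R -> R) :
  V (ord_init w) (ord_init (ord_tail x)) != 0 ->
  D (m := k.+1) (ord_init w) (ord_tail x) f * V w (ord_init x)
    - D (m := k.+1) (ord_init w) (ord_init x) f * V w (ord_tail x)
  = D (m := k.+2) w x f * V (ord_init w) (ord_init (ord_tail x)).
Proof.
move=> V_neq0; have [c fc] := V_interpolation _ _ f V_neq0.
pose g t := f t - \sum_i c i * ord_init w i t.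
have g0 i : g (ord_init (ord_tail x) i) = 0 by rewrite /g fc subrr.
(* The same [g] must serve in the larger determinant, which has one more row:
   extend the combination by the coefficient 0. *)
pose c' i := if unlift ord_max i is Some j then c j else 0.
have gE : g = fun t => f t - \sum_i c' i * w i t.
  apply/funext => t; congr (_ - _); rewrite big_ord_recr/= /c' unlift_none.
  rewrite mul0r addr0; apply: eq_bigr => i _.
  have -> : widen_ord (leqnSn k) i = lift ord_max i.
    by apply: val_inj; rewrite /= /bump leqNgt ltn_ord.
  by rewrite liftK ord_initE.
rewrite -(D_sub_comb (ord_init w) (ord_tail x) f c).
rewrite -(D_sub_comb (ord_init w) (ord_init x) f c).
rewrite -(D_sub_comb w x f c') -gE -/g.
rewrite D_vanishing_init// D_vanishing_tail ?ord_tail_init//.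
rewrite D_vanishing_interior// exprS.
have -> : ord_tail x ord_max = x ord_max by congr (x _); apply: val_inj.
have -> : ord_init x ord0 = x ord0 by congr (x _); apply: val_inj.
by ring.
Qed.

Theorem theorem1 (R : realType) (I : set R) (n : nat)
    (omega : 'I_n -> R -> R) (f : R -> R) (x : 'I_n.+1 -> R)
    (I_itv : is_interval I)
    (n_ge2 : (2 <= n)%N)
    (chebn : chebyshev_system I omega)
    (chebn1 : chebyshev_system I (ord_init omega))
    (x_in_I : forall j, I (x j))
    (x_distinct : injective x) :
  divided_difference omega (ord_tail x) f
    - divided_difference omega (ord_init x) f
  = D (m := n.+1) omega x f * V (ord_init omega) (ord_init (ord_tail x))
    / (V omega (ord_tail x) * V omega (ord_init x)).
Proof.
case: n omega x n_ge2 chebn chebn1 x_in_I x_distinct => [//|k] omega x _.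
move=> chebn chebn1 xI x_inj.
have init_inj : injective (ord_init x).
  by move=> i j /x_inj/(congr1 val)/= ij; apply: val_inj.
have tail_inj : injective (ord_tail x) by move=> i j /x_inj/lift_inj.
have inner_inj : injective (ord_init (ord_tail x)).
  by move=> i j /tail_inj/(congr1 val)/= ij; apply: val_inj.
have Vinit : V omega (ord_init x) != 0.
  by apply: V_neq0_distinct chebn _ init_inj => j; apply: xI.
have Vtail : V omega (ord_tail x) != 0.
  by apply: V_neq0_distinct chebn _ tail_inj => j; apply: xI.
have Vinner : V (ord_init omega) (ord_init (ord_tail x)) != 0.
  by apply: V_neq0_distinct chebn1 _ inner_inj => j; apply: xI.
by rewrite /divided_difference -mulNr addf_div// mulNr D_three_term.
Qed.
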